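(* Let $m\in\mathbb{Z}\setminus\{0\}$ and let $\xi,\eta\in\mathbb{Z}_m$. The equality of marked groups $\overline{BS}(m,\xi)=\overline{BS}(m,\eta)$ holds if and only if there is some $d\in\mathbb{Z}\setminus\{0\}$ such that $\gcd(\xi,m)=\gcd(\eta,m)=d$ and the images of $\xi/d$ and $\eta/d$ in $\mathbb{Z}_{m/d}$ are equal. In particular, the map $\overline{BS}_m:\mathbb{Z}_m\to\mathcal{G}_2$, $\xi\mapsto\overline{BS}(m,\xi)$, is injective on the set of invertible $m$-adic integers.
   Context: Marked groups: a marked group on $k$ generators is a pair $(G,S)$ with $S=(s_1,\dots,s_k)\in G^k$ generating $G$; marked groups are considered up to isomorphisms respecting the markings, so a marked group corresponds to a unique normal subgroup of the free group $\mathbb{F}_k$ (equality of marked groups means equality of these normal subgroups). $\mathcal{G}_k$ is the set of marked groups on $k$ generators with the ultrametric $d((G_1,S_1),(G_2,S_2))=e^{-\lambda}$, where $\lambda$ is the word length of a shortest element of $\mathbb{F}_k$ that is trivial in one group and not in the other. For $m,n\in\mathbb{Z}\setminus\{0\}$, $BS(m,n)=\langle a,b\mid ab^ma^{-1}=b^n\rangle$, marked by $(a,b)$. The ring of $m$-adic integers is $\mathbb{Z}_m=\varprojlim_h \mathbb{Z}/m^h\mathbb{Z}$ (the zero ring if $|m|=1$). For $\xi\in\mathbb{Z}_m$, $\overline{BS}(m,\xi)=\lim_{n\to\infty}BS(m,\xi_n)$ in $\mathcal{G}_2$, where $(\xi_n)_n$ is any sequence of non-zero rational integers with $|\xi_n|\to\infty$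 and $\xi_n\to\xi$ in $\mathbb{Z}_m$ (it is known that this limit exists and does not depend on the choice of $(\xi_n)_n$); it is marked by $(a,b)$. For $|m|\ge 2$ with prime factors $p_1,\dots,p_\ell$ and $\xi\in\mathbb{Z}_m$, $\gcd(\xi,m)$ is the unique number $p_1^{i_1}\cdots p_\ell^{i_\ell}$ ($i_j\in\mathbb{N}$) such that the ideal of $\mathbb{Z}_m$ generated by $\xi$ and $m$ is $p_1^{i_1}\cdots p_\ell^{i_\ell}\mathbb{Z}_m$; if $|m|=1$ the gcd is $1$ by convention. $\xi/d$ is the unique element of $\mathbb{Z}_m$ with $d\cdot(\xi/d)=\xi$. For a divisor $m'$ of $m$, the image of an element of $\mathbb{Z}_m$ in $\mathbb{Z}_{m'}$ is taken under the ring morphism induced by the projections $\mathbb{Z}/m^h\mathbb{Z}\to\mathbb{Z}/(m')^h\mathbb{Z}$. *)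

(* Defs.v *)
From HB Require Import structures.
From mathcomp Require Import all_boot all_order all_algebra.
From mathcomp Require Import all_classical all_reals all_analysis.

Set Implicit Arguments.
Unset Strict Implicit.
Unset Printing Implicit Defensive.

Import Order.TTheory GRing.Theory Num.Theory.
Import numFieldNormedType.Exports.

Local Open Scope classical_set_scope.
Local Open Scope ring_scope.

(* [(i, false)] stands for the i-th generator, [(i, true)] for its inverse. *)
Definition letter (k : nat) : Type := ('I_k * bool)%type.
HB.instance Definition _ k := Finite.on (letter k).

Definition linv k (x : letter k) : letter k := (x.1, ~~ x.2).

Definition reduced k : pred (seq (letter k)) :=
  sorted (fun x y => y != linv x).

Record freegroup (k : nat) := FreeGroup {
  fgword :> seq (letter k);
  fgword_reduced : reduced fgword }.

HB.instance Definition _ k := [isSub for @fgword k].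
HB.instance Definition _ k := [Choice of freegroup k by <:].

Section FreeGroupTheory.
Variable k : nat.
Implicit Types (x y : letter k) (u v w : seq (letter k)).

(* Reduced form of the product of a letter and a reduced word. *)
Definition lmul x w : seq (letter k) :=
  if w is y :: w' then if y == linv x then w' else x :: w else [:: x].

Lemma linvK : involutive (@linv k).
Proof. by case=> i b; rewrite /linv /= negbK. Qed.

Lemma reduced_behead x w : reduced (x :: w) -> reduced w.
Proof. by rewrite /reduced /=; case: w => //= y w /andP[]. Qed.

Lemma reduced_lmul x w : reduced w -> reduced (lmul x w).
Proof.
case: w => [//|y w] /= rw; case: ifPn => [_|yx]; first exact: reduced_behead rw.
by rewrite /reduced /= yx.
Qed.

Lemma reduced_foldr u w : reduced w -> reduced (foldr lmul w u).
Proof. by move=> rw; elim: u => //= x u /(reduced_lmul x). Qed.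

Lemma lmulKV x w : reduced w -> lmul x (lmul (linv x) w) = w.
Proof.
case: w => [_|y w] /=; first by rewrite eqxx.
rewrite linvK; case: eqP => [->|_ _]; last by rewrite /= eqxx.
by case: w => [//|z w] /= /andP[/negPf-> _].
Qed.

Lemma foldr_lmul0 u : reduced u -> foldr lmul [::] u = u.
Proof.
elim: u => //= x u IHu ru; rewrite (IHu (reduced_behead ru)).
by case: u ru {IHu} => [//|y u] /= /andP[/negPf-> _].
Qed.

Lemma foldr_lmulA u v w : reduced w ->
  foldr lmul w (foldr lmul v u) = foldr lmul (foldr lmul w v) u.
Proof.
move=> rw; elim: u => //= x u <-.
have: reduced (foldr lmul w (foldr lmul v u)) by exact: reduced_foldr.
case: (foldr lmul v u) => [//|y t] /=; case: eqP => [->|//] rt.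
by rewrite lmulKV //; apply: reduced_foldr.
Qed.

Lemma reduced_inv u : reduced u -> reduced (rev (map (@linv k) u)).
Proof.
rewrite /reduced rev_sorted sorted_map; apply: sub_sorted => x y /=.
by apply: contra_neq => ->; rewrite linvK.
Qed.

Definition fgone : freegroup k := @FreeGroup k [::] isT.
Definition fgmul (u v : freegroup k) : freegroup k :=
  FreeGroup (reduced_foldr u (fgword_reduced v)).
Definition fginv (u : freegroup k) : freegroup k :=
  FreeGroup (reduced_inv (fgword_reduced u)).

Lemma fgmulA : associative fgmul.
Proof.
by move=> u v w; apply: val_inj; rewrite /= foldr_lmulA ?fgword_reduced.
Qed.

Lemma fg1mul : left_id fgone fgmul.
Proof. by move=> u; apply: val_inj. Qed.

Lemma fgmul1 : right_id fgone fgmul.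
Proof. by move=> u; apply: val_inj; rewrite /= foldr_lmul0 ?fgword_reduced. Qed.

Lemma fginvK : involutive fginv.
Proof.
by move=> u; apply: val_inj; rewrite /= map_rev revK mapK //; exact: linvK.
Qed.

Lemma fgmulV : left_inverse fgone fginv fgmul.
Proof.
move=> u; apply: val_inj => /=; elim: (fgword u) => //= x w IHw.
by rewrite rev_cons -cats1 foldr_cat /= linvK eqxx.
Qed.

Lemma fgVmul : right_inverse fgone fginv fgmul.
Proof. by move=> u; rewrite -{1}[u]fginvK fgmulV. Qed.

HB.instance Definition _ :=
  isGroup.Build (freegroup k) fgmulA fg1mul fgmul1 fgmulV fgVmul.

Definition fggen (i : 'I_k) : freegroup k := @FreeGroup k [:: (i, false)] isT.

Definition word_length (w : freegroup k) : nat := size (fgword w).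

End FreeGroupTheory.

Definition expgz (G : groupType) (x : G) (n : int) : G :=
  match n with Posz p => (x ^+ p)%g | Negz p => (x ^- p.+1)%g end.

Definition normal_subgroup (G : groupType) (N : set G) : Prop :=
  [/\ N 1%g, forall x y : G, N x -> N y -> N (x / y)%g
    & forall x g : G, N x -> N (x ^ g)%g].

(* A marked group (G, S) on k generators, up to isomorphisms respecting the
   markings, is represented by the kernel of the morphism from the free group
   to G that sends the generators to S. The parameter [R] of the space
   [marked_space R k] only fixes the field in which distances take values. *)
Record marked_group (k : nat) := MarkedGroup {
  mg_ker : set (freegroup k);
  mg_ker_normal : normal_subgroup mg_ker }.

Definition marked_space (R : realType) (k : nat) : Type := marked_group k.

Lemma mg_ker_inj k : injective (@mg_ker k).
Proof.
move=> [M hM] [N hN] /= eMN; case: _ / eMN in hN *.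
by rewrite (Prop_irrelevance hM hN).
Qed.

HB.instance Definition _ k := gen_eqMixin (marked_group k).
HB.instance Definition _ k := gen_choiceMixin (marked_group k).
HB.instance Definition _ R k := Choice.on (marked_space R k).

Definition mg_differ k (M N : marked_group k) : set (freegroup k) :=
  [set w | mg_ker M w /\ ~ mg_ker N w \/ mg_ker N w /\ ~ mg_ker M w].

(* Only meaningful for M != N *)
Definition mg_lambda k (M N : marked_group k) : nat :=
  xget 0%N [set l | (exists2 w, mg_differ M N w & word_length w = l) /\
                    (forall w, mg_differ M N w -> (l <= word_length w)%N)].

Definition marked_dist (R : realType) k (M N : marked_space R k) : R :=
  if M == N then 0 else expR (- (mg_lambda M N)%:R).

Section MarkedMetric.
Variables (R : realType) (k : nat).
Implicit Types M N P : marked_space R k.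

Lemma mg_differC M N : mg_differ M N = mg_differ N M.
Proof. by apply/seteqP; split=> w [] ?; [right|left|right|left]. Qed.

Lemma mg_lambdaP M N : M != N ->
  (exists2 w, mg_differ M N w & word_length w = mg_lambda M N) /\
  (forall w, mg_differ M N w -> (mg_lambda M N <= word_length w)%N).
Proof.
move=> MN; rewrite /mg_lambda; case: xgetP => // noex; exfalso.
have [w0 w0P] : exists w, mg_differ M N w.
  apply: contrapT => nex; move/eqP: MN; apply; apply: mg_ker_inj.
  apply/seteqP; split=> w Hw; apply: contrapT => nHw; apply: nex; exists w.
    by left.
  by right.
have exl : exists l, `[< exists2 w, mg_differ M N w & word_length w = l >].
  by exists (word_length w0); apply/asboolP; exists w0.
apply: (noex (ex_minn exl)); case: ex_minnP => l /asboolP hl lmin; split=> //.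
by move=> w wP; apply: lmin; apply/asboolP; exists w.
Qed.

Lemma marked_distxx M : marked_dist M M = 0.
Proof. by rewrite /marked_dist eqxx. Qed.

Lemma marked_dist_positivity M N : marked_dist M N = 0 -> M = N.
Proof.
rewrite /marked_dist; case: eqP => // _ /eqP.
by rewrite gt_eqF // expR_gt0.
Qed.

Lemma marked_dist_sym M N : marked_dist M N = marked_dist N M.
Proof. by rewrite /marked_dist eq_sym /mg_lambda mg_differC. Qed.

Lemma marked_dist_ge0 M N : 0 <= marked_dist M N.
Proof. by rewrite /marked_dist; case: ifP => // _; rewrite expR_ge0. Qed.

Lemma marked_dist_ultra N M P :
  marked_dist M P <= Num.max (marked_dist M N) (marked_dist N P).
Proof.
have [->|MP] := eqVneq M P; first by rewrite marked_distxx le_max marked_dist_ge0.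
have [->|MN] := eqVneq M N; first by rewrite le_max lexx orbT.
have [<-|NP] := eqVneq N P; first by rewrite le_max lexx.
rewrite /marked_dist (negPf MP) (negPf MN) (negPf NP) le_max !ler_expR.
rewrite !lerN2 !ler_nat.
have [[w wMP <-] _] := mg_lambdaP MP.
have [_ lMN] := mg_lambdaP MN; have [_ lNP] := mg_lambdaP NP.
have [MNw|nMNw] := pselect (mg_differ M N w); first by rewrite lMN.
rewrite lNP ?orbT //.
have [Nw|nNw] := pselect (mg_ker N w); rewrite /mg_differ /= in wMP nMNw *; tauto.
Qed.

Lemma marked_dist_triangle N M P :
  marked_dist M P <= marked_dist M N + marked_dist N P.
Proof.
apply: le_trans (marked_dist_ultra N M P) _.
by rewrite ge_max lerDl lerDr !marked_dist_ge0.
Qed.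

HB.instance Definition _ := @isMetric.Build R (marked_space R k)
  (@marked_dist R k) marked_distxx marked_dist_positivity marked_dist_sym
  marked_dist_triangle.

End MarkedMetric.

Definition normal_closure (G : groupType) (A : set G) : set G :=
  [set x | forall N : set G, normal_subgroup N -> A `<=` N -> N x].

Lemma normal_closure_normal (G : groupType) (A : set G) :
  normal_subgroup (normal_closure A).
Proof.
split=> [N [] //|x y hx hy N hN AN|x g hx N hN AN].
- by case: (hN) => _ + _; apply; [exact: hx|exact: hy].
- by case: (hN) => _ _; apply; exact: hx.
Qed.

(* The group presented by < s_1, ..., s_k | A >, marked by (s_1, ..., s_k) *)
Definition presented k (A : set (freegroup k)) : marked_group k :=
  MarkedGroup (normal_closure_normal A).

(* a and b are the generators of index 0 and 1. *)
Definition BS (R : realType) (m n : int) : marked_space R 2 :=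
  let a := fggen (ord0 : 'I_2) in let b := fggen (ord_max : 'I_2) in
  presented [set (a * expgz b m * a^-1 / expgz b n)%g].

(* A coherent sequence of classes modulo m ^ h, each class being given by its
   canonical representative; coherence forces [zres h] to be reduced modulo
   m ^ h. This is the zero ring if m = 1 or m = -1. *)
Record zadic (m : int) := Zadic {
  zres :> nat -> int;
  zresS : forall h, zres h = (zres h.+1 %% m ^+ h)%Z }.

Lemma zres_inj m : injective (@zres m).
Proof.
move=> [x hx] [y hy] /= exy; case: _ / exy in hy *.
by rewrite (Prop_irrelevance hx hy).
Qed.

HB.instance Definition _ m := gen_eqMixin (zadic m).
HB.instance Definition _ m := gen_choiceMixin (zadic m).

Section ZadicRing.
Variable m : int.
Implicit Types x y z : zadic m.

Lemma zresK x h : (x h %% m ^+ h)%Z = x h.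
Proof. by rewrite zresS modz_mod. Qed.

Definition coherent (f : nat -> int) :=
  forall h, (f h = f h.+1 %[mod m ^+ h])%Z.

Lemma modz_modS (c : int) h : ((c %% m ^+ h.+1)%Z %% m ^+ h)%Z = (c %% m ^+ h)%Z.
Proof.
by rewrite [in RHS](divz_eq c (m ^+ h.+1)) exprS mulrA modzMDl.
Qed.

Definition zadic_of f (fP : coherent f) : zadic m :=
  @Zadic m (fun h => (f h %% m ^+ h)%Z)
    (fun h => etrans (fP h) (esym (modz_modS (f h.+1) h))).

Lemma coherent_zres x : coherent x.
Proof. by move=> h; rewrite zresK -zresS. Qed.

Lemma zadicP x y : (forall h, (x h = y h %[mod m ^+ h])%Z) -> x = y.
Proof.
move=> exy; apply/zres_inj/funext => h.
by rewrite -[LHS]zresK -[RHS]zresK.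
Qed.

Lemma coherent_cst (c : int) : coherent (fun=> c).
Proof. by []. Qed.

Lemma coherentD f g : coherent f -> coherent g -> coherent (fun h => f h + g h).
Proof. by move=> fP gP h; rewrite -modzDm fP gP modzDm. Qed.

Lemma coherentN f : coherent f -> coherent (fun h => - f h).
Proof. by move=> fP h; rewrite -modzNm fP modzNm. Qed.

Lemma coherentM f g : coherent f -> coherent g -> coherent (fun h => f h * g h).
Proof. by move=> fP gP h; rewrite -modzMm fP gP modzMm. Qed.

Definition zadic_int (c : int) : zadic m := zadic_of (coherent_cst c).
Definition zadic_add x y : zadic m :=
  zadic_of (coherentD (coherent_zres x) (coherent_zres y)).
Definition zadic_opp x : zadic m := zadic_of (coherentN (coherent_zres x)).
Definition zadic_mul x y : zadic m :=
  zadic_of (coherentM (coherent_zres x) (coherent_zres y)).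

Lemma zadic_addA : associative zadic_add.
Proof. by move=> x y z; apply: zadicP => h /=; rewrite !modz_mod modzDmr modzDml addrA. Qed.

Lemma zadic_addC : commutative zadic_add.
Proof. by move=> x y; apply: zadicP => h /=; rewrite addrC. Qed.

Lemma zadic_add0 : left_id (zadic_int 0) zadic_add.
Proof. by move=> x; apply: zadicP => h /=; rewrite modz_mod modzDml add0r. Qed.

Lemma zadic_addN : left_inverse (zadic_int 0) zadic_opp zadic_add.
Proof. by move=> x; apply: zadicP => h /=; rewrite !modz_mod modzDml addNr. Qed.

HB.instance Definition _ := GRing.isZmodule.Build (zadic m)
  zadic_addA zadic_addC zadic_add0 zadic_addN.

Lemma zadic_mulA : associative zadic_mul.
Proof. by move=> x y z; apply: zadicP => h /=; rewrite !modz_mod modzMmr modzMml mulrA. Qed.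

Lemma zadic_mulC : commutative zadic_mul.
Proof. by move=> x y; apply: zadicP => h /=; rewrite mulrC. Qed.

Lemma zadic_mul1 : left_id (zadic_int 1) zadic_mul.
Proof. by move=> x; apply: zadicP => h /=; rewrite modz_mod modzMml mul1r. Qed.

Lemma zadic_mulDl : left_distributive zadic_mul zadic_add.
Proof. by move=> x y z; apply: zadicP => h /=; rewrite !modz_mod modzMml modzDm mulrDl. Qed.

HB.instance Definition _ := GRing.Zmodule_isComPzRing.Build (zadic m)
  zadic_mulA zadic_mulC zadic_mul1 zadic_mulDl.

Lemma zres_intr (c : int) h : (c%:~R : zadic m) h = (c %% m ^+ h)%Z.
Proof.
suff -> : c%:~R = zadic_int c by [].
have zD a b : zadic_int (a + b) = zadic_int a + zadic_int b.
  by apply: zadicP => i /=; rewrite !modz_mod modzDm.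
have zP (n : nat) : n%:R = zadic_int n.
  by elim: n => // n IHn; rewrite -addn1 natrD IHn PoszD zD.
case: c => n; first exact: zP.
rewrite NegzE mulrNz -[_%:~R]/(_%:R) zP; apply: zadicP => i /=.
by rewrite !modz_mod modzNm.
Qed.

End ZadicRing.

(* Inverse limit of discrete spaces: the topology is induced by the product
   topology. *)
HB.instance Definition _ m := Topological.copy (zadic m)
  (initial_topology (@zres m : zadic m ->
     prod_topology (fun _ : nat => discrete_topology int))).

Lemma zadic_cvgP m (F : set_system (zadic m)) (x : zadic m) : Filter F ->
  F --> x <-> forall h, \forall y \near F, zres y h = zres x h.
Proof.
pose dres (x : zadic m) : prod_topology (fun _ : nat => discrete_topology int) :=
  zres x.
have dres_cont h : continuous (fun y : zadic m => dres y h : discrete_topology int).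
  move=> y; apply: (@continuous_comp _ _ _ dres (fun f => f h)).
    exact: initial_continuous.
  exact: (@proj_continuous _ (fun _ : nat => discrete_topology int) h).
split=> [Fx h|Fx].
  have := @dres_cont h x [set zres x h] (discrete_set1 _); exact: Fx.
move=> A; rewrite /= nbhsE => -[_ [[C oC <-] Cx] CA].
apply: filterS CA _; suff: dres @ F --> dres x.
  by apply; rewrite nbhsE; exists C.
apply/cvg_sup => h B; rewrite nbhsE => -[_ [[D _ <-] Dx] DB].
apply: filterS DB _; apply: filterS (Fx h) => y /= yxh.
by move: Dx; rewrite /= /dres yxh.
Qed.

Definition zadic_units (m : int) : set (zadic m) :=
  [set x | exists y, x * y = 1].
Arguments zadic_units : clear implicits.

Section ZadicMap.
Variables (m m' : int) (m'm : (m' %| m)%Z).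

Lemma zadic_proj_coherent (x : zadic m) : coherent m' x.
Proof.
move=> h; rewrite [X in (X %% _)%Z]zresS; apply/eqP.
rewrite eqz_mod_dvd; apply: (@dvdz_trans (m ^+ h)); first exact: dvdz_exp2r.
by rewrite -eqz_mod_dvd modz_mod.
Qed.

(* The morphism induced by the projections Z/m^h -> Z/m'^h, for m' | m *)
Definition zadic_proj (x : zadic m) : zadic m' :=
  zadic_of (zadic_proj_coherent x).

Lemma modz_modX (c : int) h : ((c %% m ^+ h)%Z %% m' ^+ h)%Z = (c %% m' ^+ h)%Z.
Proof.
apply/eqP; rewrite eqz_mod_dvd; apply: (@dvdz_trans (m ^+ h)).
  exact: dvdz_exp2r.
by rewrite -eqz_mod_dvd modz_mod.
Qed.

Lemma zadic_proj_is_zmod_morphism : zmod_morphism zadic_proj.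
Proof.
move=> x y; apply: zadicP => h /=; rewrite !modz_mod modz_modX.
rewrite -modzDmr modz_modX modzDmr modzDml modzDmr.
by rewrite -[in RHS]modzDmr modzNm modzDmr.
Qed.

Lemma zadic_proj_is_monoid_morphism : monoid_morphism zadic_proj.
Proof.
split=> [|x y]; apply: zadicP => h /=; rewrite !modz_mod modz_modX //.
by rewrite modzMm.
Qed.

HB.instance Definition _ := GRing.isZmodMorphism.Build (zadic m) (zadic m')
  zadic_proj zadic_proj_is_zmod_morphism.
HB.instance Definition _ := GRing.isMonoidMorphism.Build (zadic m) (zadic m')
  zadic_proj zadic_proj_is_monoid_morphism.

End ZadicMap.

(* Total version, with junk value 0 if m' does not divide m *)
Definition zadic_image (m m' : int) (x : zadic m) : zadic m' :=
  match @idP (m' %| m)%Z with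
  | ReflectT m'm => zadic_proj m'm x
  | ReflectF _ => 0
  end.

(* [g] is a product of powers of the prime factors of [m], and the ideals
   (x, m) and (g) of Z_m are equal. *)
Definition is_zadic_gcd (m : int) (x : zadic m) (g : nat) : Prop :=
  \pi(`|m|%N).-nat g /\
  [set z : zadic m | exists u v, z = u * x + v * m%:~R] =
  [set z : zadic m | exists w, z = g%:R * w].

Definition zadic_gcd (m : int) (x : zadic m) : nat :=
  if `|m|%N == 1%N then 1%N else xget 0%N (is_zadic_gcd x).

(* Junk value 0 if d does not divide x in Z_m *)
Definition zadic_div (m : int) (x : zadic m) (d : int) : zadic m :=
  xget 0 [set y | d%:~R * y = x].

Definition BSbar_seq (m : int) (xi : zadic m) (u : nat -> int) : Prop :=
  [/\ forall n, u n != 0,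
      (fun n => `|u n|%N) @ \oo --> \oo
    & (fun n => (u n)%:~R : zadic m) @ \oo --> xi].

(* The marked group that is the limit of BS(m, u_n) for every sequence u as
   above. The default value is never used when m != 0, since the limit exists
   and does not depend on u. *)
Definition BSbar (R : realType) (m : int) (xi : zadic m) : marked_space R 2 :=
  xget (presented set0)
    [set N : marked_space R 2 | forall u : nat -> int,
       BSbar_seq xi u -> (fun n => BS R m (u n)) @ \oo --> N].

(* Main.v *)
(** Fix m and a divisor d of m, and put m1 = m / d. For large |u|, the Britton
    reduction of a given word in BS(m, u) can be carried out symbolically: the
    exponents of b that occur have the form k0 + u (q / m), where q is again an
    exponent of this form, divisible by m. Divisibility of such an exponent by
    u just means k0 = 0, and divisibility by m depends only on u modulo a
    suitable m * m1 ^ h, where d = gcd(u, m). So BS(m, u) and BS(m, v) have the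
    same relations of length at most L as soon as |u| and |v| are large and
    u = v modulo m * m1 ^ (2 L); this gives both the existence of the limits
    and one direction of the equivalence.

    Conversely, set g_0 = a b^m a^-1 = b^u and g_(j+1) = a g_j b^k a^-1, which
    is a power of b when m divides the previous exponent plus k. The word
    [g_(j+1), b] is trivial exactly when this divisibility holds, so the
    relations of BS(m, u) determine the residues modulo m of the iterated
    exponents, which in turn determine u modulo m * m1 ^ h for all h. *)

Require Import Defs.
From mathcomp Require Import all_boot all_order all_algebra.
From mathcomp Require Import all_classical all_reals all_analysis.
From mathcomp Require Import zify ring.
From Corelib Require Setoid Morphisms RelationClasses.

Set Implicit Arguments.
Unset Strict Implicit.
Unset Printing Implicit Defensive.

Import Order.TTheory GRing.Theory Num.Theory.

Local Open Scope classical_set_scope.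
Local Open Scope ring_scope.

(* [Bot x] stands for b^x, and [Push x c s] for b^x a^{+1} s if [c] is false and
   for b^x a^{-1} s if [c] is true. *)
Inductive stack (T : Type) := Bot of T | Push of T & bool & stack T.

(** * Normal forms in BS(m, n) and the action of the generators on them *)

Section NormalForms.
Variables m n : int.
Hypotheses (m0 : m != 0) (n0 : n != 0).

(* The identities b^n a = a b^m and b^m a^-1 = a^-1 b^n reduce the exponent
   on the left of a (resp. a^-1) modulo n (resp. m). *)
Definition cosetmod (c : bool) : int := if c then m else n.

Lemma cosetmod_neq0 c : cosetmod c != 0.
Proof. by case: c. Qed.

(** Left multiplication by b^x: the remainder stays in front of a^{+-1}, while the quotient crosses
    that letter and is carried into the tail. *)
Fixpoint actb (x : int) (s : stack int) : stack int :=
  match s with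
  | Bot e => Bot (e + x)
  | Push r c s =>
      Push ((r + x) %% cosetmod c)%Z c
        (actb (((r + x) %/ cosetmod c)%Z * cosetmod (~~ c)) s)
  end.

Definition cancels (c : bool) (s : stack int) : bool :=
  if s is Push r c' _ then (r == 0) && (c' == ~~ c) else false.

Definition acta (c : bool) (s : stack int) : stack int :=
  if s is Push r c' s' then
    if (r == 0) && (c' == ~~ c) then s' else Push 0 c s
  else Push 0 c s.

(** Britton normal forms: a canonical remainder in front of each a^{+-1}, and no factor a^{+-1} b^0
    a^{-+1}. *)
Fixpoint wf (s : stack int) : bool :=
  if s is Push r c s' then
    [&& (r %% cosetmod c)%Z == r, ~~ cancels c s' & wf s']
  else true.

Lemma actaE c s : ~~ cancels c s -> acta c s = Push 0 c s.
Proof. by case: s => //= r c' s' /negPf->. Qed.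

Lemma actbD x y s : actb x (actb y s) = actb (x + y) s.
Proof.
elim: s x y => [e|r c s IHs] x y /=; first by rewrite addrAC addrA.
rewrite IHs {IHs}; set M := cosetmod c.
have M0 : M != 0 by exact: cosetmod_neq0.
have E : r + (x + y) = ((r + y) %/ M)%Z * M + (((r + y) %% M)%Z + x).
  by rewrite [RHS]addrA -divz_eq addrA addrAC.
by rewrite E modzMDl divzMDl // mulrDl (addrC (_ * _)).
Qed.

Lemma actb0 s : wf s -> actb 0 s = s.
Proof.
elim: s => [e _|r c s IHs /= /and3P[/eqP rc _ ws]] /=; first by rewrite addr0.
rewrite addr0 rc; set M := cosetmod c.
have -> : (r %/ M)%Z = 0.
  have := divz_eq r M; rewrite rc -{1}[r]add0r => /addIr/esym/eqP.
  by rewrite mulf_eq0 (negPf (cosetmod_neq0 c)) orbF => /eqP.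
by rewrite mul0r IHs.
Qed.

(** When the leading letter of [s] is the inverse one, its modulus is [cosetmod (~~ c)], so the
    leading remainder does not change. *)
Lemma cancels_actb c q s : wf s ->
  cancels c (actb (q * cosetmod (~~ c)) s) = cancels c s.
Proof.
case: s => //= r c' s' /and3P[/eqP rc _ _].
case: (c' =P ~~ c) rc => [->|_] rc; last by rewrite !andbF.
by rewrite !andbT addrC modzMDl rc.
Qed.

Lemma wf_actb x s : wf s -> wf (actb x s).
Proof.
elim: s x => //= r c s IHs x /and3P[/eqP rc ncs ws].
by rewrite modz_mod eqxx cancels_actb // ncs IHs.
Qed.

Lemma wf_acta c s : wf s -> wf (acta c s).
Proof.
case: (boolP (cancels c s)) => [|ncs ws]; last first.
  by rewrite actaE //= mod0z eqxx ncs.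
by case: s => //= r c' s' -> /and3P[].
Qed.

Lemma actaK c s : wf s -> acta (~~ c) (acta c s) = s.
Proof.
case: (boolP (cancels c s)) => [|ncs ws]; last first.
  by rewrite (actaE ncs) /=; case: c {ncs}.
case: s => //= r c' s' /andP[/eqP-> /eqP->]; rewrite !eqxx /=.
by case/and3P => _ ncs _; rewrite actaE.
Qed.

(** The defining relation, as an identity between operators on normal forms. *)
Lemma actb_coset q c s : wf s ->
  acta c (actb (q * cosetmod (~~ c)) s) = actb (q * cosetmod c) (acta c s).
Proof.
move=> ws; case: (boolP (cancels c s)) => [|ncs]; last first.
  rewrite !actaE ?cancels_actb //=.
  by rewrite add0r modzMl mulzK ?cosetmod_neq0.
case: s ws => //= r c' s' ws /andP[/eqP-> /eqP->].
by rewrite add0r modzMl mulzK ?cosetmod_neq0 // negbK !eqxx.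
Qed.

End NormalForms.

(** * Powers with integer exponents *)

Section IntegerPowers.
Variable G : groupType.
Implicit Types (x y : G) (i j : int).
Local Open Scope group_scope.

Lemma expgz_succ x i : expgz x (i + 1)%R = expgz x i * x.
Proof.
case: i => [k|[|k]]; first by rewrite -PoszD addn1 /= expgSr.
  by rewrite /= expg1 mulVg expg0.
have -> : (Negz k.+1 + 1 = Negz k)%R by rewrite !NegzE; lia.
by rewrite /= [x ^+ k.+2]expgS invgM mulgVK.
Qed.

Lemma expgzD x i j : expgz x (i + j)%R = expgz x i * expgz x j.
Proof.
elim/int_rect: j => [|j IHj|j IHj]; first by rewrite addr0 /= expg0 mulg1.
  by rewrite -addn1 PoszD addrA !expgz_succ IHj mulgA.
apply: (mulIg x); rewrite -mulgA -!expgz_succ -addrA.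
by have -> : (- j.+1%:Z + 1 = - j%:Z)%R by lia.
Qed.

Lemma expgzN x i : expgz x (- i)%R = (expgz x i)^-1.
Proof. by apply: (mulIg (expgz x i)); rewrite -expgzD addNr mulVg /= expg0. Qed.

Lemma expgzM x i j : expgz x (i * j)%R = expgz (expgz x i) j.
Proof.
elim/int_rect: j => [|j IHj|j IHj]; first by rewrite mulr0 /= !expg0.
  by rewrite -addn1 PoszD mulrDr mulr1 expgz_succ expgzD IHj.
apply: (mulIg (expgz x i)); rewrite -expgz_succ -expgzD.
by rewrite -[X in (_ + X)%R]mulr1 -mulrDr (_ : (- j.+1%:Z + 1 = - j%:Z)%R) //; lia.
Qed.

Lemma expgzJ x y i : expgz x i ^ y = expgz (x ^ y) i.
Proof. by case: i => k /=; rewrite ?conjVg conjXg. Qed.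

End IntegerPowers.

(** * Congruence modulo a normal subgroup *)

Section CongruenceModuloNormal.
Variables (G : groupType) (N : set G).
Hypothesis N_normal : normal_subgroup N.
Implicit Types x y z : G.
Local Open Scope group_scope.

Definition ncong x y : Prop := N (x / y).
Local Notation "x ~~~ y" := (ncong x y) (at level 70).

Lemma ncong_refl x : x ~~~ x.
Proof. by rewrite /ncong mulgV; case: N_normal. Qed.

Lemma ncong_sym x y : x ~~~ y -> y ~~~ x.
Proof.
move=> xy; case: N_normal => N1 Ndiv _.
by rewrite /ncong -invgF -div1g; apply: Ndiv.
Qed.

Lemma ncongM x y x' y' : x ~~~ y -> x' ~~~ y' -> x * x' ~~~ y * y'.
Proof.
move=> xy xy'; case: N_normal => N1 Ndiv NJ; rewrite /ncong.
have -> : x * x' / (y * y') = ((x' / y') ^ x^-1) / (y / x).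
  by rewrite invgF conjgE invgK invgM !mulgA mulgVK.
by apply: Ndiv; [exact: NJ|exact: ncong_sym].
Qed.

Lemma ncong_trans x y z : x ~~~ y -> y ~~~ z -> x ~~~ z.
Proof.
move=> xy /ncong_sym yz; case: N_normal => _ Ndiv _.
by rewrite /ncong -(mulgKA y^-1); apply: Ndiv.
Qed.

Lemma ncongV x y : x ~~~ y -> x^-1 ~~~ y^-1.
Proof.
move=> xy; case: N_normal => _ _ NJ.
have := NJ _ y (ncong_sym xy); rewrite conjgE /ncong invgK.
by rewrite -mulgA mulKg.
Qed.

Lemma ncong1 x : x ~~~ 1 <-> N x.
Proof. by rewrite /ncong divg1. Qed.

Lemma ncong_expgz x y i : x ~~~ y -> expgz x i ~~~ expgz y i.
Proof.
move=> xy; have xyX k : x ^+ k ~~~ y ^+ k.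
  elim: k => [|k IHk]; first by rewrite !expg0; exact: ncong_refl.
  by rewrite !expgS; exact: ncongM.
by case: i => k //=; exact: ncongV.
Qed.

End CongruenceModuloNormal.

(** * The word problem in BS(m, n), and the test words *)

Section WordProblem.
Variables (R : realType) (m n : int).
Hypotheses (m0 : m != 0) (n0 : n != 0).

Definition bs_a : freegroup 2 := fggen ord0.
Definition bs_b : freegroup 2 := fggen ord_max.

(** The words g_j of the outline, latest k first. In BS(m, u) such a word equals b to the power
    [nested_exp u ks], provided that all divisions by m are exact, as [nested_valid] records. *)
Fixpoint nested_word (ks : seq int) : freegroup 2 :=
  if ks is k :: ks' then (bs_a * (nested_word ks' * expgz bs_b k) / bs_a)%g
  else (bs_a * expgz bs_b m / bs_a)%g.

Fixpoint nested_exp (u : int) (ks : seq int) : int :=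
  if ks is k :: ks' then u * ((nested_exp u ks' + k) %/ m)%Z else u.

Fixpoint nested_valid (u : int) (ks : seq int) : bool :=
  if ks is k :: ks' then
    (m %| nested_exp u ks' + k)%Z && nested_valid u ks'
  else true.

Definition test_word (ks : seq int) : freegroup 2 :=
  (nested_word ks * bs_b / nested_word ks / bs_b)%g.

Definition actl (x : letter 2) (s : stack int) : stack int :=
  if x.1 == ord0 then acta x.2 s else actb m n (if x.2 then -1 else 1) s.

Definition act (w : seq (letter 2)) (s : stack int) : stack int :=
  foldr actl s w.

Let actbD := actbD m0 n0.

Lemma wf_actl x s : wf m n s -> wf m n (actl x s).
Proof. by rewrite /actl; case: eqP => _; [exact: wf_acta|exact: wf_actb]. Qed.

Lemma wf_act w s : wf m n s -> wf m n (act w s).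
Proof. by move=> ws; elim: w => //= x w; exact: wf_actl. Qed.

Lemma actlK x s : wf m n s -> actl (linv x) (actl x s) = s.
Proof.
move=> ws; rewrite /actl /=; case: eqP => _; first exact: actaK ws.
by rewrite actbD -[RHS](actb0 m0 n0) //; case: x.2.
Qed.

Lemma act_lmul x w s : wf m n s -> act (lmul x w) s = actl x (act w s).
Proof.
case: w => //= y w ws; case: eqP => //= ->.
by rewrite -{1}[x]linvK actlK // wf_act.
Qed.

Lemma actM (x y : freegroup 2) s :
  wf m n s -> act (x * y)%g s = act x (act y s).
Proof.
rewrite [fgword _]/=; case: x => w _ /=; elim: w => //= l w IHw ws.
by rewrite act_lmul // IHw.
Qed.

Definition act_ker : set (freegroup 2) :=
  [set w | forall s, wf m n s -> act w s = s].

Lemma act_ker_normal : normal_subgroup act_ker.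
Proof.
split=> [//|x y hx hy s ws|x g hx s ws].
  by rewrite actM // hx ?wf_act // -{1}[s]hy ?wf_act // -actM // mulVg.
rewrite conjgE !actM ?wf_act // hx ?wf_act //.
by rewrite -actM // mulVg.
Qed.

Lemma act_expgz_b i s : wf m n s -> act (expgz bs_b i) s = actb m n i s.
Proof.
move=> ws; elim/int_rect: i => [|k IHk|k IHk]; first by rewrite /= actb0.
  by rewrite (_ : k.+1%:Z = 1 + k%:Z) // expgzD actM // IHk -actbD.
by rewrite (_ : - k.+1%:Z = -1 - k%:Z) ?expgzD ?actM // ?IHk -?actbD //; lia.
Qed.

Lemma act_a s : act bs_a s = acta false s. Proof. by []. Qed.
Lemma act_aV s : act (bs_a^-1)%g s = acta true s. Proof. by []. Qed.

(** The normal closure is minimal among normal subgroups containing the relator, so it suffices that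
    the relator acts trivially. *)
Lemma BS_act w : mg_ker (BS R m n) w -> act_ker w.
Proof.
apply; first exact: act_ker_normal.
move=> _ -> s ws.
rewrite !actM ?wf_act // -/bs_a -/bs_b.
rewrite -expgzN [act (expgz bs_b (- n)) s]act_expgz_b //.
rewrite act_a act_aV act_expgz_b ?wf_acta ?wf_actb //.
have := actb_coset m0 n0 1 false (wf_acta true (wf_actb (- n) ws)).
rewrite !mul1r => ->.
by rewrite (actaK true (wf_actb (- n) ws)) actbD subrr actb0.
Qed.


Let N := mg_ker (BS R m n).
Let N_normal : normal_subgroup N := mg_ker_normal (BS R m n).

Local Notation "x === y" := (ncong N x y) (at level 70).

Let ncongN_refl x : x === x := ncong_refl N_normal x.
#[local] Hint Resolve ncongN_refl : core.

#[local] Instance ncongN_equiv : RelationClasses.Equivalence (ncong N).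
Proof.
split; [exact: ncong_refl|exact: ncong_sym|exact: ncong_trans].
Qed.

#[local] Instance ncongN_mul :
  Morphisms.Proper (Morphisms.respectful (ncong N)
    (Morphisms.respectful (ncong N) (ncong N)))
    ( *%g : freegroup 2 -> freegroup 2 -> freegroup 2).
Proof. by move=> x y xy x' y' xy'; exact: (ncongM N_normal). Qed.

#[local] Instance ncongN_expgz :
  Morphisms.Proper (Morphisms.respectful (ncong N)
    (Morphisms.respectful eq (ncong N))) (@expgz (freegroup 2)).
Proof. by move=> x y xy i _ <-; exact: (ncong_expgz N_normal). Qed.

Definition genpow_a (c : bool) : freegroup 2 := if c then (bs_a^-1)%g else bs_a.

Lemma BS_coset c q :
  (genpow_a c * expgz bs_b (q * cosetmod m n (~~ c)) ===
   expgz bs_b (q * cosetmod m n c) * genpow_a c)%g.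
Proof.
have rel : (expgz bs_b m ^ bs_a^-1 === expgz bs_b n)%g.
  by rewrite conjgE invgK mulgA; refine (fun N' _ relN' => relN' _ _).
have relq : (bs_a * expgz bs_b (q * m) / bs_a === expgz bs_b (q * n))%g.
  rewrite -{1}[bs_a]invgK -mulgA -conjgE ![(q * _)%R]mulrC !expgzM expgzJ.
  by rewrite rel.
case: c => /=; last by rewrite -relq mulgVK.
by rewrite -relq -mulgA mulKg.
Qed.

Fixpoint stack_elt (s : stack int) : freegroup 2 :=
  match s with
  | Bot e => expgz bs_b e
  | Push r c s => (expgz bs_b r * (genpow_a c * stack_elt s))%g
  end.

Lemma stack_elt_actb x s :
  (stack_elt (actb m n x s) === expgz bs_b x * stack_elt s)%g.
Proof.
elim: s x => [e|r c s IHs] x /=; first by rewrite addrC expgzD.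
rewrite IHs [(genpow_a c * _)%g]mulgA BS_coset !mulgA -!expgzD.
by rewrite [((_ %% _)%Z + _)%R]addrC -divz_eq [(r + x)%R]addrC.
Qed.

Lemma stack_elt_acta c s :
  (stack_elt (acta c s) === genpow_a c * stack_elt s)%g.
Proof.
case: (boolP (cancels c s)) => [|ncs]; last by rewrite actaE //= expg0 mul1g.
case: s => //= r c' s /andP[/eqP-> /eqP->]; rewrite !eqxx /= expg0 mul1g mulgA.
by case: c => /=; rewrite ?mulVg ?mulgV mul1g.
Qed.

Lemma stack_elt_act (w : freegroup 2) s :
  (stack_elt (act w s) === w * stack_elt s)%g.
Proof.
have letterE (x : letter 2) t :
    (stack_elt (actl x t) === @FreeGroup 2 [:: x] isT * stack_elt t)%g.
  case: x => i c; rewrite /actl /=; case: eqP => [->|/eqP i0].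
    rewrite stack_elt_acta.
    suff -> : genpow_a c = @FreeGroup 2 [:: (ord0, c)] isT by [].
    by apply: val_inj; case: c.
  rewrite stack_elt_actb.
  suff -> : expgz bs_b (if c then -1 else 1) =
    @FreeGroup 2 [:: (i, c)] isT by [].
  have -> : i = ord_max by apply: val_inj; case: i i0 => [[|[]]].
  by apply: val_inj; case: c.
case: w => w rw /=; elim: w rw => [|x w IHw] rw /=.
  rewrite (_ : FreeGroup rw = 1%g) ?mul1g; first by [].
  exact: val_inj.
have rw' := reduced_behead rw; rewrite letterE (IHw rw').
rewrite (_ : FreeGroup rw = @FreeGroup 2 [:: x] isT * FreeGroup rw')%g.
  by rewrite -mulgA.
apply: val_inj => /=; case: w rw {IHw rw'} => //= y w.
by rewrite /reduced /= => /andP[/negPf-> _].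
Qed.

(** The action factors through the group, whence one direction. Conversely, acting on [Bot 0] yields
    a normal form whose spelling by [stack_elt] is congruent to w. *)
Lemma BS_kerP (w : freegroup 2) : N w <-> act w (Bot 0) = Bot 0.
Proof.
split=> [/BS_act|w0]; first exact.
have := stack_elt_act w (Bot 0); rewrite w0 /= expg0 mulg1.
by move/(ncong_sym N_normal)/ncong1.
Qed.

#[local] Instance ncongN_inv :
  Morphisms.Proper (Morphisms.respectful (ncong N) (ncong N))
    (@monoid.inv (freegroup 2)).
Proof. by move=> x y xy; exact: (ncongV N_normal). Qed.

Lemma nested_word_cong ks : nested_valid n ks ->
  ncong N (nested_word ks) (expgz bs_b (nested_exp n ks)).
Proof.
have aE q : (bs_a * expgz bs_b (q * m) / bs_a === expgz bs_b (q * n))%g.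
  by rewrite -[X in _ === X](mulgK bs_a) -(BS_coset false).
elim: ks => [_|k ks IHks /= /andP[mk vks]].
  by have := aE 1; rewrite !mul1r.
by rewrite IHks // -expgzD -[X in expgz _ X](divzK mk) aE mulrC.
Qed.

(** If m divides the exponent y, the nested word is a power of b and commutes with b. Otherwise the
    commutator is a b^y a^-1 b a b^-y a^-1 b^-1, where the middle b cannot be pinched because |n| >
    1. *)
Lemma test_word_ker k ks : nested_valid n ks -> (1 < `|n|)%N ->
  N (test_word (k :: ks)) <-> (m %| nested_exp n ks + k)%Z.
Proof.
move=> vks n1; split=> [|mk]; last first.
  have vk : nested_valid n (k :: ks) by rewrite /= mk.
  apply/(ncong1 N (test_word (k :: ks))).
  rewrite /test_word nested_word_cong //.
  by rewrite -expgz_succ addrC expgzD [expgz _ 1]/= mulgK mulgV.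
set y := nested_exp n ks + k => Nt; apply/negPn/negP => ndvd.
(* If m does not divide y, then t is reduced. *)
pose t := (bs_a * (expgz bs_b y * (bs_a^-1 * (expgz bs_b 1 *
  (bs_a * (expgz bs_b (- y) * (bs_a^-1 * expgz bs_b (-1))))))))%g.
have /BS_kerP : N t.
  apply/(ncong1 N t); apply: (ncong_trans N_normal) (proj2 (ncong1 N _) Nt).
  rewrite /test_word /= nested_word_cong // -expgzD -/y.
  by rewrite !invgM invgK -expgzN /t !mulgA.
have r1 : ((0 - y) %% m == 0)%Z = false.
  by apply/negP => /eqP/dvdz_mod0P; rewrite sub0r rpredN; exact/negP.
have r2 : ((0 + 1) %% n == 0)%Z = false.
  apply/negP => /eqP/dvdz_mod0P; rewrite add0r dvdz1.
  by move: n1; case: eqP => [->|].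
have r3 : ((0 + y) %% m == 0)%Z = false.
  by apply/negP => /eqP/dvdz_mod0P; rewrite add0r; exact/negP.
rewrite /t !actM ?wf_act //.
rewrite !act_expgz_b ?wf_act ?wf_actb //.
rewrite act_a act_aV act_a act_aV /= r1 /= r2 /= r3 //.
all: by do ?[apply: wf_act|apply: wf_actb].
Qed.

End WordProblem.

(** * Lengths of the test words *)

Lemma word_lengthM (x y : freegroup 2) :
  (word_length (x * y)%g <= word_length x + word_length y)%N.
Proof.
have lmulS l w : (size (@lmul 2 l w) <= (size w).+1)%N.
  by case: w => //= l' w; case: ifP => //= _; rewrite ltnW.
rewrite /word_length /=; elim: (fgword x) => //= l w IHw.
by apply: leq_trans (lmulS _ _) _; rewrite addSn ltnS.
Qed.

Lemma word_lengthV (x : freegroup 2) : word_length (x^-1)%g = word_length x.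
Proof. by rewrite /word_length /= size_rev size_map. Qed.

Lemma word_length_expgz_b i : (word_length (expgz bs_b i) <= `|i|)%N.
Proof.
have bX k : (word_length (bs_b ^+ k)%g <= k)%N.
  elim: k => [|k IHk]; first by rewrite expg0.
  by rewrite expgS; apply: leq_trans (word_lengthM _ _) _; rewrite add1n ltnS.
by case: i => k; rewrite /expgz ?word_lengthV; apply: bX.
Qed.

Lemma word_length_nested_word m ks : all (fun k => `|k| <= `|m|)%N ks ->
  (word_length (nested_word m ks) <= (`|m| + 2) * (size ks).+1)%N.
Proof.
have conj_a (x : freegroup 2) :
    (word_length (bs_a * x / bs_a)%g <= word_length x + 2)%N.
  have := word_lengthM (bs_a * x)%g (bs_a^-1)%g; have := word_lengthM bs_a x.
  rewrite word_lengthV /word_length /= => h1 h2; lia.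
elim: ks => [_|k ks IHks] /=.
  by apply: leq_trans (conj_a _) _; rewrite muln1 leq_add2r word_length_expgz_b.
case/andP=> km /IHks le; apply: leq_trans (conj_a _) _.
have := word_lengthM (nested_word m ks) (expgz bs_b k).
have := word_length_expgz_b k; nia.
Qed.

Lemma word_length_test_word m ks : all (fun k => `|k| <= `|m|)%N ks ->
  (word_length (test_word m ks) <= 2 * ((`|m| + 2) * (size ks).+1) + 2)%N.
Proof.
move=> /word_length_nested_word; rewrite /test_word.
have := word_lengthM (nested_word m ks) bs_b.
have := word_lengthM (nested_word m ks * bs_b)%g (nested_word m ks)^-1%g.
have := word_lengthM (nested_word m ks * bs_b / nested_word m ks)%g (bs_b^-1)%g.
have wb : word_length bs_b = 1%N by [].
rewrite !word_lengthV wb; lia.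
Qed.

Lemma dvdz_congr (m x y : int) : (m %| x - y)%Z -> (m %| x)%Z = (m %| y)%Z.
Proof. by move=> mxy; rewrite -[in LHS](subrK y x) rpredDl. Qed.

(** * Symbolic Britton reduction for large |u| *)

Section SymbolicExponents.
Variable m : int.
Hypothesis m0 : m != 0.
Implicit Types (u v k : int) (p q : seq int).

(* With t = u / m, the list [k0; k1; ...] encodes the exponent
   k0 + k1 t + k2 t ^ 2 + ..., evaluated with exact divisions only if
   [lvalid] holds. *)
Fixpoint lev u p : int := if p is k :: q then k + u * (lev u q %/ m)%Z else 0.

Fixpoint lvalid u p : bool :=
  if p is _ :: q then (m %| lev u q)%Z && lvalid u q else true.

Fixpoint padd p q : seq int :=
  match p, q with
  | k :: p', l :: q' => (k + l) :: padd p' q'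
  | [::], _ => q
  | _, [::] => p
  end.

(** Counting entries as well as coefficients lets one number bound both the coefficients, to be
    compared with |u|, and the number of divisions by m. *)
Fixpoint pnorm p : nat := if p is k :: q then (`|k| + 1 + pnorm q)%N else 0%N.

Lemma padd_valid u p q : lvalid u p -> lvalid u q ->
  lvalid u (padd p q) /\ lev u (padd p q) = lev u p + lev u q.
Proof.
elim: p q => [|k p IHp] [|l q] //=; rewrite ?add0r ?addr0 //.
move=> /andP[mp vp] /andP[mq vq]; have [vpq ->] := IHp q vp vq.
by rewrite vpq rpredD // divzDl // mulrDr; split=> //; ring.
Qed.

Lemma pnorm_padd p q : (pnorm (padd p q) <= pnorm p + pnorm q)%N.
Proof.
elim: p q => [|k p IHp] [|l q] //=; rewrite ?addn0 //.
have := IHp q; lia.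
Qed.

Lemma size_pnorm p : (size p <= pnorm p)%N.
Proof. by elim: p => //= k p IHp; lia. Qed.

Lemma dvdz_small u k : (`|k| < `|u|)%N -> (u %| k)%Z -> k = 0.
Proof.
rewrite dvdzE => ku /dvdn_leq uk; apply/eqP; rewrite -absz_eq0.
by case: posnP => // /uk; rewrite leqNgt ku.
Qed.

(** A zero value forces u to divide the head, which is smaller than |u| and hence zero; dividing by
    u / m then leaves the tail. *)
Lemma lev_eq0 u p : lvalid u p -> (pnorm p <= `|u|)%N ->
  (lev u p == 0) = all (pred1 0) p.
Proof.
elim: p => //= k p IHp /andP[mp vp] nu; rewrite -IHp //; last by lia.
have u0 : u != 0 by lia.
apply/eqP/andP => [e|[/eqP-> /eqP->]]; last by rewrite div0z mulr0.
have k0 : k = 0.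
  apply: (@dvdz_small u); first by lia.
  by rewrite -[k](addrK (u * (lev u p %/ m)%Z)) e sub0r rpredN dvdz_mulr.
split; first by rewrite k0.
move: e; rewrite k0 add0r => /eqP; rewrite mulf_eq0 (negPf u0) /= => /eqP e.
by rewrite -(divzK mp) e mul0r.
Qed.

Section Dependence.
Variables (d m1 u v : int) (h : nat).
Hypotheses (mE : m = d * m1) (du : (d %| u)%Z) (uv : (m * m1 ^+ h %| u - v)%Z).

(** Dividing by m turns precision m m1^(i+1) into m1^(i+1), and multiplying by u, a multiple of d,
    gives d m1^(i+1) = m m1^i. So each list entry costs one factor m1. *)
Lemma lev_congr p i : (size p + i <= h)%N ->
  lvalid u p = lvalid v p /\
  (lvalid u p -> (m * m1 ^+ i %| lev u p - lev v p)%Z).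
Proof.
elim: p i => [|k p IHp] i /= szh; first by rewrite subrr dvdz0.
have ih : (i <= h)%N by exact: leq_trans (leq_addl _ _) szh.
have [|<- dvd] := IHp i.+1; first by rewrite addnS.
have [vp|] := boolP (lvalid u p); last by rewrite !andbF.
have {}dvd := dvd vp.
have mdvd : (m %| lev u p)%Z = (m %| lev v p)%Z.
  have : (m %| lev u p - lev v p)%Z.
    by apply: dvdz_trans dvd; exact: dvdz_mulr.
  exact: dvdz_congr.
rewrite !andbT -mdvd; split=> // mp; move: (mp); rewrite mdvd => mp'.
have [x xE] := dvdzP mp; have [y yE] := dvdzP mp'.
have [t tE] := dvdzP du.
rewrite xE yE !mulzK //.
have xy : (m1 ^+ i.+1 %| x - y)%Z.
  move: dvd; rewrite xE yE -mulrBl [m * _]mulrC dvdz_mul2r //.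
have -> : k + u * x - (k + v * y) = u * (x - y) + (u - v) * y by ring.
apply: rpredD.
  rewrite mE -mulrA -exprS; exact: dvdz_mul.
apply: dvdz_mulr; apply: dvdz_trans uv.
by rewrite dvdz_mul2l // dvdz_exp2l.
Qed.

End Dependence.

(* Whether a^{+-1} b^p a^{-+1} is a power of b; for [c = true] the test is
   divisibility by u, provided |u| is large with respect to p. *)
Definition spinch u (c : bool) p : bool :=
  if c then head 0 p == 0 else (m %| lev u p)%Z.

(** Conjugation by a multiplies the exponent by t = u / m, and conjugation by a^-1 divides it by
    t. *)
Definition shift_exp (c : bool) p : seq int := if c then behead p else 0 :: p.

Lemma shift_expP u c p : lvalid u p -> spinch u c p ->
  lvalid u (shift_exp c p) /\ exists k,
    lev u p = k * cosetmod m u (~~ c) /\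
    lev u (shift_exp c p) = k * cosetmod m u c.
Proof.
case: c => /= vp; last first.
  move=> mp; rewrite mp vp; split=> //; exists (lev u p %/ m)%Z.
  by rewrite divzK // add0r mulrC.
case: p vp => [|k p] /=; first by split=> //; exists 0; rewrite !mul0r.
move=> /andP[mp vp] /eqP->; split=> //; exists (lev u p %/ m)%Z.
by rewrite divzK // add0r mulrC.
Qed.

(** All terms after the head are multiples of u, and the head is smaller than |u|. *)
Lemma spinchE u c p : lvalid u p -> (pnorm p <= `|u|)%N ->
  (cosetmod m u (~~ c) %| lev u p)%Z = spinch u c p.
Proof.
case: c => //=; case: p => [|k p] /=; first by rewrite dvdz0 eqxx.
move=> _ nu; rewrite rpredDr ?dvdz_mulr //.
apply/idP/eqP => [/dvdz_small->|->] //; last exact: dvdz0.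
by lia.
Qed.

(** Symbolic stacks keep their exponents unreduced, so multiplying by b^p only touches the top.
    Pinches are still removed, and [slev] recovers the normal form. *)
Definition addtop p (st : stack (seq int)) : stack (seq int) :=
  match st with
  | Bot q => Bot (padd p q)
  | Push q c st => Push (padd p q) c st
  end.

Definition scancels u c (st : stack (seq int)) : bool :=
  if st is Push p c' _ then (c' == ~~ c) && spinch u c p else false.

Definition sacta u c (st : stack (seq int)) : stack (seq int) :=
  if st is Push p c' st' then
    if (c' == ~~ c) && spinch u c p then addtop (shift_exp c p) st'
    else Push [::] c st
  else Push [::] c st.

Definition sactl u (x : letter 2) (st : stack (seq int)) : stack (seq int) :=
  if x.1 == ord0 then sacta u x.2 st
  else addtop [:: if x.2 then -1 else 1] st.

Definition srun u (w : seq (letter 2)) : stack (seq int) :=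
  foldr (sactl u) (Bot [::]) w.

Fixpoint snorm (st : stack (seq int)) : nat :=
  match st with
  | Bot p => pnorm p
  | Push p _ st => (pnorm p + 1 + snorm st)%N
  end.

Fixpoint svalid u (st : stack (seq int)) : bool :=
  match st with
  | Bot p => lvalid u p
  | Push p _ st => lvalid u p && svalid u st
  end.

Fixpoint sreduced u (st : stack (seq int)) : bool :=
  if st is Push _ c st' then ~~ scancels u c st' && sreduced u st' else true.

Fixpoint slev u (st : stack (seq int)) : stack int :=
  match st with
  | Bot p => Bot (lev u p)
  | Push p c st => actb m u (lev u p) (acta c (slev u st))
  end.

Lemma sactaE u c st : ~~ scancels u c st -> sacta u c st = Push [::] c st.
Proof. by case: st => //= p c' st' /negPf->. Qed.

Lemma pnorm_shift_exp c p : (pnorm (shift_exp c p) <= pnorm p + 1)%N.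
Proof. by case: c => /=; [case: p => //= k p|]; lia. Qed.

Lemma snorm_addtop p st : (snorm (addtop p st) <= pnorm p + snorm st)%N.
Proof. by case: st => [q|q c st] /=; have := pnorm_padd p q; lia. Qed.

(** A letter b adds at most 2, one for the coefficient and one for a new list entry; a letter
    a^{+-1} adds at most 1, as a pinch trades a stack cell for a longer list. *)
Lemma snorm_sactl u x st : (snorm (sactl u x st) <= snorm st + 2)%N.
Proof.
rewrite /sactl; case: eqP => _; last first.
  by apply: leq_trans (snorm_addtop _ _) _; case: x.2 => /=; lia.
case: (boolP (scancels u x.2 st)) => [|ns]; last by rewrite sactaE //=; lia.
case: st => //= p c st ->; apply: leq_trans (snorm_addtop _ _) _.
by have := pnorm_shift_exp x.2 p; lia.
Qed.

Lemma snorm_srun u w : (snorm (srun u w) <= 2 * size w)%N.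
Proof. by elim: w => //= x w IHw; have := snorm_sactl u x (srun u w); lia. Qed.

Section Evaluation.
Variable u : int.
Hypothesis u0 : u != 0.

Lemma svalid_addtop p st : lvalid u p -> svalid u st -> svalid u (addtop p st).
Proof.
case: st => [q|q c st] /= vp; first by case/(padd_valid vp).
by case/andP=> /(padd_valid vp)[-> _] ->.
Qed.

Lemma svalid_sactl x st : svalid u st -> svalid u (sactl u x st).
Proof.
rewrite /sactl; case: eqP => _ vS; last first.
  by apply: svalid_addtop => //=; rewrite dvdz0.
case: (boolP (scancels u x.2 st)) => [|ns]; last by rewrite sactaE.
case: st vS => //= p c st /andP[vp vS] /andP[-> xp]; rewrite xp /=.
by apply: svalid_addtop => //; case: (shift_expP vp xp).
Qed.

Lemma svalid_srun w : svalid u (srun u w).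
Proof. by elim: w => //= x w; exact: svalid_sactl. Qed.

Lemma sreduced_sactl x st : sreduced u st -> sreduced u (sactl u x st).
Proof.
have add p T : sreduced u (addtop p T) = sreduced u T by case: T.
rewrite /sactl; case: eqP => _ rS; last by rewrite add.
case: (boolP (scancels u x.2 st)) => [|ns]; last by rewrite sactaE //= ns.
by case: st rS => //= p c st /andP[_ rS] ->; rewrite add.
Qed.

Lemma sreduced_srun w : sreduced u (srun u w).
Proof. by elim: w => //= x w; exact: sreduced_sactl. Qed.

Lemma wf_slev st : wf m u (slev u st).
Proof. by elim: st => //= p c st wS; apply/wf_actb/wf_acta. Qed.

Lemma slev_addtop p st : lvalid u p -> svalid u st ->
  slev u (addtop p st) = actb m u (lev u p) (slev u st).
Proof.
case: st => [q|q c st] vp /=.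
  by case/(padd_valid vp) => _ ->; rewrite addrC.
by case/andP=> /(padd_valid vp)[_ ->] _; rewrite actbD.
Qed.

(** By [shift_expP] a symbolic pinch is a genuine one, so [actb_coset] justifies its removal; a
    letter that is pushed acts by the definition of [slev]. *)
Lemma slev_sactl x st : svalid u st ->
  slev u (sactl u x st) = actl m u x (slev u st).
Proof.
move=> vS; rewrite /sactl /actl; case: eqP => _; last first.
  by rewrite slev_addtop //= ?dvdz0 // div0z mulr0 addr0.
case: (boolP (scancels u x.2 st)) => [|ns]; last first.
  by rewrite sactaE //= actb0 // wf_acta // wf_slev.
case: st vS => //= p c st /andP[vp vS] /andP[/eqP-> xp]; rewrite xp eqxx /=.
have [vp' [q [pE p'E]]] := shift_expP vp xp.
rewrite slev_addtop // p'E pE actb_coset ?wf_acta ?wf_slev //.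
by have := actaK (~~ x.2) (wf_slev st); rewrite negbK => ->.
Qed.

Lemma slev_srun w : slev u (srun u w) = act m u w (Bot 0).
Proof. by elim: w => //= x w IHw; rewrite slev_sactl ?svalid_srun // IHw. Qed.

(** Largeness of |u| enters here: it ensures that no genuine pinch escapes the symbolic test. *)
Lemma cancels_slev c st : svalid u st -> sreduced u st ->
  (snorm st <= `|u|)%N ->
  cancels c (slev u st) = scancels u c st.
Proof.
elim: st c => //= p c' st IHS c /andP[vp vS] /andP[ns rS] nu.
rewrite actaE; last by rewrite IHS //; lia.
rewrite /= add0r andbC; case: eqP => //= ->.
rewrite -spinchE ?(leq_trans _ nu) //; last by lia.
by apply/eqP/idP => /dvdz_mod0P.
Qed.

Lemma act_Bot0 w : (2 * size w <= `|u|)%N ->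
  act m u w (Bot 0) = Bot 0 <->
  if srun u w is Bot p then all (pred1 0) p else False.
Proof.
move=> wu; rewrite -slev_srun.
have := svalid_srun w; have := sreduced_srun w; have := snorm_srun u w.
case: (srun u w) => /= [p nw _ vp|p c st nw /andP[ns rS] /andP[vp vS]].
  rewrite -(@lev_eq0 u) //; last by lia.
  by split=> [[->]|/eqP->].
by split=> //; rewrite actaE //= cancels_slev //; lia.
Qed.

End Evaluation.

(** The run depends on u only through the tests of divisibility by m. The exponents tested have at
    most h entries, so [lev_congr] gives the same answer for u and v. *)
Lemma srun_congr (d m1 u v : int) h w :
  m = d * m1 -> (d %| u)%Z -> (m * m1 ^+ h %| u - v)%Z ->
  (2 * size w <= h)%N -> srun u w = srun v w.
Proof.
move=> mE du uv; elim: w => //= x w IHw wh.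
rewrite -IHw; last by lia.
have := svalid_srun u w; have := snorm_srun u w.
case: (srun u w) => [p _ _|p c st /= nw /andP[vp _]]; rewrite /sactl /sacta //.
suff -> : spinch u x.2 p = spinch v x.2 p by [].
rewrite /spinch; case: x.2 => //.
have ph : (size p + 0 <= h)%N by have := size_pnorm p; lia.
have [_ /(_ vp) dvd] := @lev_congr d m1 u v h mE du uv p 0 ph.
have : (m %| lev u p - lev v p)%Z by apply: dvdz_trans dvd; exact: dvdz_mulr.
exact: dvdz_congr.
Qed.

Lemma BS_ker_congr (R : realType) (d m1 u v : int) h (w : freegroup 2) :
  m = d * m1 -> (d %| u)%Z -> (m * m1 ^+ h %| u - v)%Z ->
  (2 * word_length w <= h)%N -> (h < `|u|)%N -> (h < `|v|)%N ->
  mg_ker (BS R m u) w <-> mg_ker (BS R m v) w.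
Proof.
move=> mE du uv wh hu hv.
have u0 : u != 0 by lia.
have v0 : v != 0 by lia.
rewrite !BS_kerP // !act_Bot0 //; try by rewrite /word_length in wh; lia.
by rewrite (srun_congr mE du uv).
Qed.

End SymbolicExponents.

(** * Recovering congruences on u from short relations *)

Section Detection.
Variable m : int.
Hypothesis m0 : m != 0.

(** Each k is the residue in [0, |m|) that makes the next division by m exact. *)
Fixpoint digits (u : int) (j : nat) : seq int :=
  if j is j'.+1 then
    (- nested_exp m u (digits u j') %% m)%Z :: digits u j'
  else [::].

Lemma size_digits u j : size (digits u j) = j.
Proof. by elim: j => //= j ->. Qed.

Lemma digits_small u j : all (fun k => `|k| <= `|m|)%N (digits u j).
Proof.
elim: j => //= j ->; rewrite andbT.
have := modz_ge0 (- nested_exp m u (digits u j)) m0.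
have := ltz_mod (- nested_exp m u (digits u j)) m0.
set r := modz _ _; lia.
Qed.

Lemma nested_valid_digits u j : nested_valid m u (digits u j).
Proof.
elim: j => //= j ->; rewrite andbT; apply/dvdz_mod0P.
by rewrite modzDmr addrN mod0z.
Qed.

(** Reverses the loss of precision in [lev_congr]. Successive exponents satisfy u x - v y = (u - v)
    y + u (x - y), and u / d is coprime to m1; so agreement modulo m m1^i at step j + 1 and for u, v
    yields agreement modulo m m1^(i+1) at step j. *)
Lemma nested_exp_congr (d m1 u v : int) h :
  m = d * m1 -> gcdz u m = d -> nested_valid m v (digits u h.+1) ->
  (m * m1 ^+ h %| u - v)%Z.
Proof.
move=> mE gE vh.
have d0 : d != 0 by apply: contra_neq m0 => d0; rewrite mE d0 mul0r.
have m10 : m1 != 0 by apply: contra_neq m0 => m10; rewrite mE m10 mulr0.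
have [u1 uE] : exists u1, u = u1 * d.
  by apply/dvdzP; rewrite -gE dvdz_gcdl.
have cop : coprimez m1 u1.
  rewrite /coprimez -(inj_eq (mulIf d0)) mul1r.
  have dE : `|d|%:Z = d by rewrite -gE.
  by rewrite -[X in _ * X == _]dE mulz_gcdl -uE mulrC -mE gcdzC gE.
pose diff j := nested_exp m u (digits u j) - nested_exp m v (digits u j).
have vj j : (j <= h.+1)%N -> nested_valid m v (digits u j).
  move=> jh; have := vh; rewrite -(subnK jh).
  by elim: (h.+1 - j)%N => //= k IHk /andP[_ /IHk].
have quot j : (j <= h)%N -> exists x y,
    [/\ diff j = (x - y) * m, nested_exp m u (digits u j.+1) = u * x
      & nested_exp m v (digits u j.+1) = v * y].
  move=> jh; have /= /andP[/dvdzP[x xE] _] := nested_valid_digits u j.+1.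
  have /= /andP[/dvdzP[y yE] _] := vj j.+1 jh.
  exists x, y; rewrite /= xE yE !mulzK //; split=> //.
  by rewrite mulrBl -xE -yE /diff; ring.
(* The goal is the case i = h, j = 0, since [diff 0] is u - v. *)
suff: forall i j, (i + j <= h)%N -> (m * m1 ^+ i %| diff j)%Z.
  by move/(_ h 0%N); rewrite addn0; apply.
elim=> [|i IHi] j ijh.
  have [x [y [-> _ _]]] := quot j ijh.
  by rewrite expr0 mulr1 dvdz_mull.
have jh : (j <= h)%N by exact: leq_trans (leq_addl _ _) ijh.
have [x [y [-> ux vy]]] := quot j jh.
rewrite [m * _]mulrC dvdz_mul2r //.
have uv : (m * m1 ^+ i %| u - v)%Z.
  have := IHi 0%N; apply; rewrite addn0.
  by apply: leq_trans (leq_addr j _) (ltnW ijh).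
have := IHi j.+1; rewrite addnS => /(_ ijh); rewrite /diff ux vy.
have -> : u * x - v * y = (u - v) * y + u * (x - y) by ring.
rewrite rpredDl; last exact: dvdz_mulr.
rewrite mE uE.
rewrite [u1 * d]mulrC -[d * u1 * _]mulrA -[d * m1 * _]mulrA dvdz_mul2l // -exprS.
by rewrite Gauss_dvdzr // coprimezXl.
Qed.

(** The digits of u are shown valid for v one at a time, each through a test word with at most h + 1
    digits; hence h + 2 in the length bound. *)
Lemma BS_ker_detect (R : realType) (m1 u v : int) h :
  m = gcdz u m * m1 -> (1 < `|u|)%N -> (1 < `|v|)%N ->
  (forall w : freegroup 2,
     (word_length w <= 2 * ((`|m| + 2) * h.+2) + 2)%N ->
     mg_ker (BS R m u) w <-> mg_ker (BS R m v) w) ->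
  (m * m1 ^+ h %| u - v)%Z.
Proof.
move=> mE u1 v1 uv; apply: (nested_exp_congr mE) => //.
have u0 : u != 0 by lia.
have v0 : v != 0 by lia.
suff: forall j, (j <= h.+1)%N -> nested_valid m v (digits u j) by apply.
elim=> // j IHj jh.
have vj : nested_valid m v (digits u j) by apply/IHj/ltnW.
have := nested_valid_digits u j.+1; rewrite /= vj !andbT.
case/andP=> /(test_word_ker R m0 u0 _ (nested_valid_digits u j) u1) uj _.
apply/(test_word_ker R m0 v0 _ vj v1)/uv => //.
apply: leq_trans (word_length_test_word (digits_small u j.+1)) _.
by rewrite size_digits leq_add2r !leq_mul2l ltnS jh !orbT.
Qed.

End Detection.

(** * Convergence of marked groups as agreement on short words *)

Section MarkedConvergence.
Variables (R : realType) (k : nat).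
Implicit Types M N : marked_space R k.

Definition agree_upto (L : nat) M N : Prop :=
  forall w, (word_length w <= L)%N -> mg_ker M w <-> mg_ker N w.

Lemma marked_dist_lt M N L :
  marked_dist M N < expR (- L%:R) <-> agree_upto L M N.
Proof.
rewrite /marked_dist; case: eqVneq => [->|MN].
  by split=> // _; exact: expR_gt0.
rewrite ltr_expR ltrN2 ltr_nat.
have [[w0 w0MN w0l] lmin] := mg_lambdaP MN; split=> [lt w wL|agr].
  suff : ~ mg_differ M N w.
    rewrite /mg_differ /=.
    by have := EM (mg_ker M w); have := EM (mg_ker N w); tauto.
  by move/lmin; rewrite leqNgt (leq_ltn_trans wL).
rewrite ltnNge; apply/negP => le; have := agr w0; rewrite w0l => /(_ le).
by move: w0MN; rewrite /mg_differ /=; tauto.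
Qed.

Lemma marked_cvgP (f : nat -> marked_space R k) N :
  f @ \oo --> N <-> forall L, \forall n \near \oo, agree_upto L N (f n).
Proof.
split=> [/metricType_numDomainType.cvgrPdist_lt fN L|fN].
  have := fN _ (expR_gt0 (- L%:R)); apply: filterS => n.
  by move/marked_dist_lt.
apply/metricType_numDomainType.cvgrPdist_lt => e e0.
have := fN (Num.bound `|ln e|); apply: filterS => n /marked_dist_lt.
move/lt_trans; apply; rewrite -[ltRHS]lnK // ltr_expR ltrNl.
by apply: le_lt_trans (archi_boundP (normr_ge0 _)); rewrite -normrN ler_norm.
Qed.

End MarkedConvergence.

(** * Existence of the limits, and their equality in terms of residues *)

Section AdicResidues.
Variable m : int.
Hypothesis m0 : m != 0.
Implicit Types x y xi eta : zadic m.

Lemma zres_le x h n : (h <= n)%N -> (x n %% m ^+ h)%Z = x h.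
Proof.
elim: n => [|n IHn]; first by rewrite leqn0 => /eqP->; exact: zresK.
rewrite leq_eqVlt => /predU1P[->|hn]; first exact: zresK.
rewrite -(IHn hn) [x n]zresS; apply/eqP; rewrite eqz_mod_dvd.
apply: (@dvdz_trans (m ^+ n)); first exact: dvdz_exp2l.
by rewrite -eqz_mod_dvd modz_mod.
Qed.

Lemma zres_dvd x h n : (h <= n)%N -> (m ^+ h %| x n - x h)%Z.
Proof. by move=> hn; rewrite -eqz_mod_dvd zres_le // zresK. Qed.

Lemma zres_dvd1 x d h : (d %| m)%Z -> (d %| x h.+1)%Z = (d %| x 1%N)%Z.
Proof.
move=> dm; apply: dvdz_congr; apply: (dvdz_trans dm _).
by have := @zres_dvd x 1 h.+1; rewrite expr1; apply.
Qed.

Lemma BSbar_seq_zres xi u h : BSbar_seq xi u ->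
  \forall n \near \oo, (m ^+ h %| u n - xi h)%Z.
Proof.
case=> _ _ /zadic_cvgP/(_ h) uh.
have {uh} : \forall n \near \oo, ((u n)%:~R : zadic m) h = xi h by exact: uh.
by apply: filterS => n; rewrite zres_intr => un; rewrite -eqz_mod_dvd un zresK.
Qed.

Lemma BSbar_seq_ex xi : exists u, BSbar_seq xi u.
Proof.
(* The added multiple of m^n keeps the residue and drives the sequence to infinity, even when |m| =
   1. *)
pose u n := xi n + n.+1%:Z * `|m ^+ n|.
have ule n : n.+1%:Z <= u n.
  have : 0 <= xi n by rewrite -zresK modz_ge0 // expf_neq0.
  have : 1 <= `|m ^+ n| by rewrite -gtz0_ge1 normr_gt0 expf_neq0.
  by rewrite /u; nia.
exists u; split=> [n||].
- by apply: contraTneq (ule n) => ->.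
- apply/cvgnyPge => A; exists A => // n /= An; have := ule n; lia.
apply/zadic_cvgP => h; exists h => // n /= hn.
rewrite zres_intr -[RHS](zres_le xi hn).
apply/eqP; rewrite eqz_mod_dvd /u addrAC subrr add0r.
by apply: dvdz_mull; rewrite -abszE dvdzE; exact: (dvdz_exp2l m hn).
Qed.

(** The congruences of the outline for all h, with d read off from the residue modulo m. Level h + 1
    determines them because m m1^h divides m^(h+1). *)
Definition zadic_close xi eta : Prop :=
  forall h, (m * (m %/ gcdz (xi 1%N) m)%Z ^+ h %| xi h.+1 - eta h.+1)%Z.

(** Far out, the sequences agree with xi and eta modulo m^(h+1), so [BS_ker_congr] applies. The
    indices vary independently, so that the case eta = xi serves as a Cauchy property. *)
Lemma zadic_close_seq xi eta u v : BSbar_seq xi u -> BSbar_seq eta v ->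
  zadic_close xi eta -> forall (R : realType) L, exists K, forall n n',
    (K <= n)%N -> (K <= n')%N -> agree_upto L (BS R m (u n)) (BS R m (v n')).
Proof.
move=> xiu etav cl R L; pose h := (2 * L)%N.
have [_ u_oo _] := xiu; have [_ v_oo _] := etav.
have /cvgnyPgt/(_ h) [K1 _ uK1] := u_oo.
have /cvgnyPgt/(_ h) [K2 _ vK2] := v_oo.
have [K3 _ uK3] := BSbar_seq_zres h.+1 xiu.
have [K4 _ vK4] := BSbar_seq_zres h.+1 etav.
exists (maxn (maxn K1 K2) (maxn K3 K4)) => n n'.
rewrite !geq_max => /andP[/andP[K1n K2n] /andP[K3n K4n]].
move=> /andP[/andP[K1n' K2n'] /andP[K3n' K4n']] w wL.
have dm := dvdz_gcdr (xi 1%N) m.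
have mE : m = gcdz (xi 1%N) m * (m %/ gcdz (xi 1%N) m)%Z by rewrite mulrC divzK.
apply: (@BS_ker_congr m m0 R (gcdz (xi 1%N) m)
  (m %/ gcdz (xi 1%N) m)%Z _ _ h) => //.
- have /dvdz_congr-> : (gcdz (xi 1%N) m %| u n - xi h.+1)%Z.
    apply: dvdz_trans (uK3 n K3n); rewrite exprS; exact: dvdz_mulr.
  by rewrite zres_dvd1 // dvdz_gcdl.
- have -> : u n - v n' =
      (u n - xi h.+1) - (v n' - eta h.+1) + (xi h.+1 - eta h.+1) by ring.
  apply: rpredD (cl h); apply: (@dvdz_trans (m ^+ h.+1)).
    by rewrite exprS dvdz_mul2l // dvdz_exp2r // [X in (_ %| X)%Z]mE dvdz_mull.
  by apply: rpredB; [exact: uK3|exact: vK4].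
- by rewrite leq_mul2l wL orbT.
- exact: uK1.
- exact: vK2.
Qed.

(** The words eventually trivial along one sequence form the kernel of a limit common to all
    sequences, so [xget] does not return its default. *)
Lemma BSbar_cvg (R : realType) xi u :
  BSbar_seq xi u -> (fun n => BS R m (u n)) @ \oo --> BSbar R xi.
Proof.
have clxx : zadic_close xi xi by move=> h; rewrite subrr dvdz0.
have [u0 u0xi] := BSbar_seq_ex xi.
pose N := [set w | \forall n \near \oo, mg_ker (BS R m (u0 n)) w].
have N_normal : normal_subgroup N.
  split=> [|x y hx hy|x g hx]; rewrite /N /=.
  - by apply: nearW => n; case: (mg_ker_normal (BS R m (u0 n))).
  - apply: filterS2 hx hy => n.
    by case: (mg_ker_normal (BS R m (u0 n))) => _ + _; exact.
  - apply: filterS hx => n.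
    by case: (mg_ker_normal (BS R m (u0 n))) => _ _ +; exact.
rewrite /BSbar; case: xgetP => [y _ yP|no]; first exact: yP.
case: (no (MarkedGroup N_normal)) => v vxi; apply/marked_cvgP => L.
have [K agr] := zadic_close_seq u0xi vxi clxx R L.
exists K => // n /= Kn w wL; split=> [[K' _ u0w]|vw].
  have /= u0w' := u0w (maxn K K') (leq_maxr _ _).
  by apply/(agr (maxn K K') n (leq_maxl _ _) Kn w wL).
by exists K => // n' /= Kn'; apply/(agr n' n Kn' Kn w wL).
Qed.

Lemma BSbar_eq_close (R : realType) xi eta :
  BSbar R xi = BSbar R eta <-> zadic_close xi eta.
Proof.
have [u xiu] := BSbar_seq_ex xi; have [v etav] := BSbar_seq_ex eta.
have /marked_cvgP cu := @BSbar_cvg R _ _ xiu.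
have /marked_cvgP cv := @BSbar_cvg R _ _ etav.
split=> [e h|cl]; last first.
  apply/mg_ker_inj/seteqP.
  suff agr w : mg_ker (BSbar R xi) w <-> mg_ker (BSbar R eta) w.
    by split=> w /agr.
  have [K agr] := zadic_close_seq xiu etav cl R (word_length w).
  have [K1 _ c1] := cu (word_length w); have [K2 _ c2] := cv (word_length w).
  pose n := maxn K (maxn K1 K2).
  have /= c1n := c1 n (leq_trans (leq_maxl _ _) (leq_maxr _ _)) w (leqnn _).
  have /= c2n := c2 n (leq_trans (leq_maxr _ _) (leq_maxr _ _)) w (leqnn _).
  have agrn := agr n n (leq_maxl _ _) (leq_maxl _ _) w (leqnn _).
  by rewrite c1n c2n.
(* Both sequences of groups now have the same limit, hence share their short relations far out. *)
rewrite -e in cv.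
pose L := (2 * ((`|m| + 2) * h.+2) + 2)%N.
have [_ u_oo _] := xiu; have [_ v_oo _] := etav.
have /cvgnyPgt/(_ 1%N) u1 := u_oo.
have /cvgnyPgt/(_ 1%N) v1 := v_oo.
near \oo => n.
have un1 : (1 < `|u n|)%N by near: n.
have vn1 : (1 < `|v n|)%N by near: n.
have uxi : (m ^+ h.+1 %| u n - xi h.+1)%Z by near: n; exact: BSbar_seq_zres.
have veta : (m ^+ h.+1 %| v n - eta h.+1)%Z by near: n; exact: BSbar_seq_zres.
have aun : agree_upto L (BSbar R xi) (BS R m (u n)) by near: n; exact: cu.
have avn : agree_upto L (BSbar R xi) (BS R m (v n)) by near: n; exact: cv.
have dm := dvdz_gcdr (xi 1%N) m.
have mE : m = gcdz (xi 1%N) m * (m %/ gcdz (xi 1%N) m)%Z by rewrite mulrC divzK.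
set m1 := (m %/ _)%Z in mE *.
have gE : gcdz (u n) m = gcdz (xi 1%N) m.
  have um : (m %| u n - xi 1%N)%Z.
    have -> : u n - xi 1%N = (u n - xi h.+1) + (xi h.+1 - xi 1%N) by ring.
    apply: rpredD.
      by apply: dvdz_trans uxi; rewrite exprS; exact: dvdz_mulr.
    by have := @zres_dvd xi 1 h.+1; rewrite expr1; apply.
  by move: um; rewrite -eqz_mod_dvd => /eqP um; rewrite -gcdz_modl um gcdz_modl.
have uv : (m * m1 ^+ h %| u n - v n)%Z.
  apply: (@BS_ker_detect m m0 R m1) => //; first by rewrite gE.
  by move=> w wL; rewrite -(aun w wL) -(avn w wL).
have -> : xi h.+1 - eta h.+1 =
    (u n - v n) - ((u n - xi h.+1) - (v n - eta h.+1)) by ring.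
apply: (rpredB uv); apply: (@dvdz_trans (m ^+ h.+1)); last exact: rpredB.
by rewrite exprS dvdz_mul2l // dvdz_exp2r // [X in (_ %| X)%Z]mE dvdz_mull.
Unshelve. all: by end_near. Qed.

End AdicResidues.

(** * Gcd, quotients and images of m-adic integers *)

Section AdicGcd.
Variable m : int.
Hypothesis m0 : m != 0.
Implicit Types x y xi eta : zadic m.

(** Division by a divisor of m costs at most one power of m, so level h of the quotient is taken
    from level h + 1 of x. *)
Lemma zadic_dvd d x : d != 0 -> (d %| m)%Z -> (d %| x 1%N)%Z ->
  exists y, d%:~R * y = x.
Proof.
move=> d0 dm dx; have dxS h : (d %| x h.+1)%Z by rewrite zres_dvd1.
have co : coherent m (fun h => x h.+1 %/ d)%Z.
  move=> h; apply/esym/eqP; rewrite eqz_mod_dvd -(@dvdz_mul2l d) // mulrBr.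
  rewrite ![d * (_ %/ _)%Z]mulrC !divzK //.
  apply: (@dvdz_trans (m ^+ h.+1)); last exact: zres_dvd.
  by rewrite exprS dvdz_mul.
exists (zadic_of co); apply: zadicP => h.
rewrite /= !modz_mod !zres_intr modzMm mulrC divzK //.
by rewrite zres_le // zresK.
Qed.

Lemma dvdn_exp_pnat (g n : nat) : (0 < n)%N -> \pi(n).-nat g -> (g %| n ^ g)%N.
Proof.
move=> n_gt0 gn; have g_gt0 : (0 < g)%N by case/andP: gn.
apply/dvdn_partP => // p pg; rewrite p_part.
apply: (@dvdn_trans (p ^ g)); first by rewrite dvdn_exp2l // ltnW // ltn_logl.
rewrite dvdn_exp2r //; have : p \in \pi(n) by exact: (pnatPpi gn).
by rewrite mem_primes => /and3P[].
Qed.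

(** The equation is read modulo m^g', which is a multiple of g'. *)
Lemma natr_dvd_zadic (g g' : nat) (w : zadic m) :
  \pi(`|m|%N).-nat g' -> g%:R = g'%:R * w -> (g' %| g)%N.
Proof.
move=> g'm e; have m_gt0 : (0 < `|m|)%N by rewrite absz_gt0.
have dvd : (g'%:Z %| m ^+ g')%Z by rewrite dvdzE abszX dvdn_exp_pnat.
have := congr1 (fun x : zadic m => x g') e.
rewrite /= -[g%:R]/(g%:Z%:~R : zadic m) -[g'%:R]/(g'%:Z%:~R : zadic m).
rewrite !zres_intr modzMml => /eqP; rewrite eqz_mod_dvd => /(dvdz_trans dvd).
by move/dvdz_congr; rewrite dvdz_mulr // dvdzE /= => ->.
Qed.

(** Replacing xi by its residue modulo m keeps the ideal (xi, m), so integer Bezout gives a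
    generator. Uniqueness follows by applying [natr_dvd_zadic] both ways. *)
Lemma zadic_gcdE xi : (zadic_gcd xi)%:Z = gcdz (xi 1%N) m.
Proof.
rewrite /zadic_gcd; case: eqP => [m1|_].
  rewrite /gcdz m1 gcdn1 //.
set g := gcdn `|xi 1%N| `|m|.
have gE : g%:Z = gcdz (xi 1%N) m by [].
have m_gt0 : (0 < `|m|)%N by rewrite absz_gt0.
have g0 : g%:Z != 0 by rewrite gE gcdz_eq0 (negPf m0) andbF.
have gP : is_zadic_gcd xi g.
  split; first exact: (pnat_dvd (dvdn_gcdr _ _) (pnat_pi m_gt0)).
  have [y yE] := zadic_dvd g0 (dvdz_gcdr (xi 1%N) m) (dvdz_gcdl (xi 1%N) m).
  have [q mE] := dvdzP (dvdz_gcdr (xi 1%N) m).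
  have mZE : m%:~R = q%:~R * g%:~R :> zadic m by rewrite -intrM gE -mE.
  have [z zE] : exists z, m%:~R * z = xi - (xi 1%N)%:~R.
    apply: zadic_dvd => //=.
    rewrite zres_intr expr1.
    apply/dvdz_mod0P.
    by rewrite modz_mod modzDmr -modzDmr modzNm modzDmr addrN mod0z.
  have [a [b abE]] := Bezoutz (xi 1%N) m.
  apply/seteqP; split=> [_ [u [v ->]]|_ [w ->]] /=.
    exists (u * y + v * q%:~R); rewrite mZE -[in LHS]yE; ring.
  (* Obtained by substituting xi - m z for the residue of xi in the Bezout identity. *)
  exists (a%:~R * w), ((b%:~R - a%:~R * z) * w).
  have -> : g%:R = a%:~R * (xi 1%N)%:~R + b%:~R * m%:~R :> zadic m.
    by rewrite -!intrM -intrD abE.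
  rewrite -[(xi 1%N)%:~R](subKr xi) -zE; ring.
have [g'm g'E] : is_zadic_gcd xi (xget 0%N (is_zadic_gcd xi)).
  by apply: xgetPex; exists g.
set g' := xget _ _ in g'm g'E *.
rewrite -gE; congr Posz; apply/eqP; rewrite eqn_dvd.
have [gm gI] := gP; rewrite gI in g'E.
have /= [w wE] : [set z : zadic m | exists w, z = g%:R * w] g'%:R.
  by rewrite g'E; exists 1; rewrite mulr1.
have /= [w' w'E] : [set z : zadic m | exists w, z = g'%:R * w] g%:R.
  by rewrite -g'E; exists 1; rewrite mulr1.
by rewrite (natr_dvd_zadic gm wE) (natr_dvd_zadic g'm w'E).
Qed.

Lemma zadic_image_eq m' x y : (m' %| m)%Z ->
  zadic_image m' x = zadic_image m' y <->
  forall h, (m' ^+ h.+1 %| x h.+1 - y h.+1)%Z.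
Proof.
rewrite /zadic_image; case: {-}_ / idP => // m'm _; split=> [e h|e].
  by rewrite -eqz_mod_dvd; apply/eqP/(congr1 (fun z : zadic m' => z h.+1) e).
apply: zadicP => -[|h]; first by rewrite expr0 !modz1.
by rewrite /= !modz_mod; apply/eqP; rewrite eqz_mod_dvd.
Qed.

(** Multiplication by d turns the modulus m1^(h+1) into m m1^h and the quotients back into xi and
    eta. *)
Lemma zadic_close_image xi eta d :
  gcdz (xi 1%N) m = d -> gcdz (eta 1%N) m = d ->
  zadic_close xi eta <->
  zadic_image (m %/ d)%Z (zadic_div xi d) =
  zadic_image (m %/ d)%Z (zadic_div eta d).
Proof.
move=> dxi deta; have dm : (d %| m)%Z by rewrite -dxi dvdz_gcdr.
have d0 : d != 0 by rewrite -dxi gcdz_eq0 (negPf m0) andbF.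
have mE := divzK dm; rewrite /zadic_close dxi; set m1 := (m %/ d)%Z in mE *.
have divE (x : zadic m) : gcdz (x 1%N) m = d -> forall h,
    (m ^+ h %| d * zadic_div x d h - x h)%Z.
  move=> dx h; have dx1 : (d %| x 1%N)%Z by rewrite -dx dvdz_gcdl.
  have := xgetPex 0 (zadic_dvd d0 dm dx1); rewrite -/(zadic_div x d) => xE.
  rewrite -{2}xE -eqz_mod_dvd /= zres_intr modz_mod modzMml.
  exact: eqxx.
rewrite zadic_image_eq; last by rewrite -mE dvdz_mulr.
have sub h : (m * m1 ^+ h %| m ^+ h.+1)%Z.
  by rewrite exprS dvdz_mul2l // dvdz_exp2r // -mE dvdz_mulr.
suff E h : (m * m1 ^+ h %| xi h.+1 - eta h.+1)%Z =
    (m1 ^+ h.+1 %| zadic_div xi d h.+1 - zadic_div eta d h.+1)%Z.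
  by split=> cl h; [rewrite -E|rewrite E].
have dE : d * m1 ^+ h.+1 = m * m1 ^+ h by rewrite exprS mulrA [d * _]mulrC mE.
rewrite -[RHS](@dvdz_mul2l d) // dE; apply/esym/dvdz_congr.
have -> : d * (zadic_div xi d h.+1 - zadic_div eta d h.+1) -
    (xi h.+1 - eta h.+1)
  = (d * zadic_div xi d h.+1 - xi h.+1) - (d * zadic_div eta d h.+1 - eta h.+1).
  by ring.
by apply: rpredB; apply: dvdz_trans (sub h) _; exact: divE.
Qed.

Lemma zadic_close_gcd xi eta :
  zadic_close xi eta -> gcdz (xi 1%N) m = gcdz (eta 1%N) m.
Proof.
move/(_ 0%N); rewrite expr0 mulr1 -eqz_mod_dvd => /eqP e.
by rewrite -gcdz_modl e gcdz_modl.
Qed.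

Lemma gcdz_unit xi : zadic_units m xi -> gcdz (xi 1%N) m = 1.
Proof.
case=> y /(congr1 (fun x : zadic m => x 1%N)); rewrite /= expr1 => e.
(* Bezout coefficients from xi y = 1 modulo m; the term [1 %/ m] accounts for |m| = 1, where
   [1 %% m] is 0. *)
apply/eqP/coprimezP; exists (y 1%N, (1 %/ m)%Z - (xi 1%N * y 1%N %/ m)%Z) => /=.
rewrite [y 1%N * _]mulrC mulrBl {1}(divz_eq (xi 1%N * y 1%N) m) e.
by rewrite [RHS](divz_eq 1 m); ring.
Qed.

(** With d = 1 one has m1 = m, and the moduli are all the powers of m. *)
Lemma zadic_close_unit xi eta :
  gcdz (xi 1%N) m = 1 -> zadic_close xi eta -> xi = eta.
Proof.
move=> g1; rewrite /zadic_close g1 divz1 => cl.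
apply: zadicP => -[|h]; first by rewrite expr0 !modz1.
by apply/eqP; rewrite eqz_mod_dvd exprS.
Qed.

End AdicGcd.

Local Close Scope classical_set_scope.

Theorem theorem1 (R : realType) (m : int) (hm : m != 0) :
  (forall xi eta : zadic m,
     BSbar R xi = BSbar R eta <->
     exists d : int,
       [/\ d != 0, (zadic_gcd xi)%:Z = d, (zadic_gcd eta)%:Z = d
         & zadic_image (m %/ d)%Z (zadic_div xi d) =
           zadic_image (m %/ d)%Z (zadic_div eta d)]) /\
  {in zadic_units m &, injective (@BSbar R m)}.
Proof.
split=> [xi eta|xi eta /set_mem /gcdz_unit g1 _]; last first.
  by move/(BSbar_eq_close hm); exact: zadic_close_unit.
rewrite BSbar_eq_close //; split=> [cl|[d [_]]].
  exists (gcdz (xi 1%N) m); have g := zadic_close_gcd cl.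
  rewrite !zadic_gcdE // gcdz_eq0 (negPf hm) andbF -g; split=> //.
  by apply/zadic_close_image.
by rewrite !zadic_gcdE // => dxi deta /(zadic_close_image hm dxi deta).
Qed.
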